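(* Every node $p \notin S_0$ that is active at time $t_p^e + 2D$ joins by time $t_p^e + 2D$.
   Context: Model: an asynchronous message-passing system in which an adversary generates, for each node $p$, at most one Enter($p$), Leave($p$) and Crash($p$) signal (a Leave($p$) signal for a crashed node $p$ may be generated at another active node, a forced leave, which counts toward churn). A node is present at time $t$ if it has entered but not left by $t$; $N(t)$ is the number of nodes present at time $t$, with $N(t) \geq N_{min}$ always; $S_0$ is the set of nodes present at time 0. A crashed node takes no more steps; a node is active at $t$ if present and not crashed by $t$. Nodes communicate by broadcast: a message broadcast by $p$ at time $t$ is received within $D$ time by every node $q \neq p$ active throughout $[t,t+D]$ ($D$ unknown to nodes, no lower bound on delays; FIFO per sender/receiver pair). Churn: for some constant $\alpha<1$, for all $t$ at most $\alpha N(t)$ nodes enter or leave during $[t,t+D]$. Failures: for some constant $\Delta<1$, at any time $t$ at most $\Delta N(t)$ present nodes have crashed. Algorithm (CCReg, joining part): each node $p$ keeps a set $Changes_p$ of events $enter(q)$, $join(q)$, $leave(q)$; initially $Changes_p = \{enter(q), join(q) : q \in S_0\}$ if $p \in S_0$ and empty otherwise; $Present_p = \{q : enter(q) \in Changes_p, leave(q) \notin Changes_p\}$. Nodes of $S_0$ are joined at time 0. When $p$ receives Enter($p$), it adds $enter(p)$ to $Changes_p$ and broadcasts an enter message; $t_p^e$ is this time. A node receiving an enter message from $q$ adds $enter(q)$ to its Changes set and broadcasts an enter-echo containing its Changes set, its register value and timestamp, its is_joined flag, and $q$. On receiving an enter-echo, a node unions the contained Changes set into its own; if the echo is addressed to $p$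 and $p$ has not joined, then the first time such an echo comes from a joined node $p$ sets $join\_bound := \gamma |Present_p|$, $p$ increments $join\_counter$, and once $join\_counter \geq join\_bound > 0$, $p$ joins: it sets is_joined, adds $join(p)$ and broadcasts a joined message. Receivers of a joined message for $q$ add $join(q)$, $enter(q)$ and broadcast a joined-echo (whose receivers do the same); a leave message for $q$ (broadcast by $q$, or by another node for a forced leave) causes receivers to add $leave(q)$ and broadcast a leave-echo, whose receivers add $leave(q)$. Assumptions: $\alpha \leq 1 - 2^{-1/4}$; $1 < ((1-\alpha)^3 - \Delta(1+\alpha)^3)N_{min}$; $\gamma \geq \frac{1}{N_{min}(1-\alpha)^3} + (1+\Delta)\frac{(1+\alpha)^3}{(1-\alpha)^3} - 1$; $\gamma \leq \frac{(1-\alpha)^3}{(1+\alpha)^3} - \Delta$. *)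

(* Defs.v *)
From Stdlib Require Import Reals Lra List Arith Bool.
Open Scope bool_scope.
Import ListNotations.
Open Scope R_scope.

Definition Node := nat.

Inductive Ev : Type :=
| EvEnter (q : Node)
| EvJoin (q : Node)
| EvLeave (q : Node).

Definition ev_eq_dec : forall x y : Ev, {x = y} + {x <> y}.
Proof. decide equality; apply Nat.eq_dec. Defined.

Definition add_ev (e : Ev) (c : list Ev) : list Ev :=
  if in_dec ev_eq_dec e c then c else c ++ [e].

Definition union_ev (c d : list Ev) : list Ev :=
  fold_left (fun acc e => add_ev e acc) d c.

Definition present_set (c : list Ev) : list Node :=
  nodup Nat.eq_dec
    (flat_map (fun e => match e with
                        | EvEnter q =>
                            if in_dec ev_eq_dec (EvLeave q) c then [] else [q]
                        | _ => []
                        end) c).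

(** * Local state of a node (joining part of CCReg) *)
Record LState : Type := mkLState {
  changes : list Ev;
  is_joined : bool;
  join_counter : nat;
  join_bound : R;
  bound_set : bool   (* whether an enter-echo from a joined node has already set join_bound *)
}.

Definition set_changes (s : LState) (c : list Ev) : LState :=
  mkLState c (is_joined s) (join_counter s) (join_bound s) (bound_set s).

(** Messages (register value / timestamp fields of enter-echo are not modelled) *)
Inductive Msg : Type :=
| MEnter (q : Node)
| MEnterEcho (C : list Ev) (j : bool) (q : Node)
| MJoined (q : Node)
| MJoinedEcho (q : Node)
| MLeave (q : Node)
| MLeaveEcho (q : Node).

Inductive LInput : Type :=
| LEnter
| LLeave (q : Node)      (* Leave(q) signal at p (q = p, or forced leave of crashed q) *)
| LCrash
| LRecv (m : Msg)
| LNone.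

Definition trans (gamma : R) (p : Node) (s : LState) (inp : LInput)
  : LState * option Msg :=
  match inp with
  | LEnter =>
      (set_changes s (add_ev (EvEnter p) (changes s)), Some (MEnter p))
  | LLeave q =>
      (set_changes s (add_ev (EvLeave q) (changes s)), Some (MLeave q))
  | LCrash => (s, None)
  | LNone => (s, None)
  | LRecv m =>
      match m with
      | MEnter q =>
          let c := add_ev (EvEnter q) (changes s) in
          (set_changes s c, Some (MEnterEcho c (is_joined s) q))
      | MEnterEcho C j q =>
          let c := union_ev (changes s) C in
          if negb (is_joined s) && Nat.eqb q p then
            let jb := if j && negb (bound_set s)
                      then gamma * INR (length (present_set c))
                      else join_bound s in
            let bs := bound_set s || j in
            let cnt := S (join_counter s) in
            if Rle_dec jb (INR cnt) then
              if Rlt_dec 0 jb then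
                (mkLState (add_ev (EvJoin p) c) true cnt jb bs, Some (MJoined p))
              else (mkLState c false cnt jb bs, None)
            else (mkLState c false cnt jb bs, None)
          else (set_changes s c, None)
      | MJoined q =>
          (set_changes s (add_ev (EvEnter q) (add_ev (EvJoin q) (changes s))),
           Some (MJoinedEcho q))
      | MJoinedEcho q =>
          (set_changes s (add_ev (EvEnter q) (add_ev (EvJoin q) (changes s))), None)
      | MLeave q =>
          (set_changes s (add_ev (EvLeave q) (changes s)), Some (MLeaveEcho q))
      | MLeaveEcho q =>
          (set_changes s (add_ev (EvLeave q) (changes s)), None)
      end
  end.

Definition init_state (S0 : list Node) (p : Node) : LState :=
  if in_dec Nat.eq_dec p S0
  then mkLState (flat_map (fun q => [EvEnter q; EvJoin q]) S0) true 0 0 false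
  else mkLState [] false 0 0 false.

Inductive Input : Type :=
| IEnter
| ILeave (q : Node)
| ICrash
| IRecv (j : nat)       (* the node receives the message broadcast at step j *)
| IIdle.                (* no-op (padding) *)

Record Step : Type := mkStep { s_time : R; s_node : Node; s_input : Input }.

Definition Execution := nat -> Step.

Fixpoint run (gamma : R) (S0 : list Node) (ex : Execution) (n : nat)
  : (Node -> LState) * (nat -> option Msg) :=
  match n with
  | O => (init_state S0, fun _ => None)
  | S k =>
      let (cf, ms) := run gamma S0 ex k in
      let st := ex k in
      let p := s_node st in
      let inp := match s_input st with
                 | IEnter => LEnter
                 | ILeave q => LLeave q
                 | ICrash => LCrash
                 | IIdle => LNone
                 | IRecv j => match ms j with Some m => LRecv m | None => LNone end
                 end in
      let (s', out) := trans gamma p (cf p) inp in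
      (fun q => if Nat.eqb q p then s' else cf q,
       fun i => if Nat.eqb i k then out else ms i)
  end.

Definition broadcast gamma S0 ex (i : nat) : option Msg :=
  snd (run gamma S0 ex (S i)) i.

Definition state_after gamma S0 ex (i : nat) (p : Node) : LState :=
  fst (run gamma S0 ex (S i)) p.

Definition entered_by (ex : Execution) (S0 : list Node) (t : R) (q : Node) : Prop :=
  In q S0 \/ exists i, s_node (ex i) = q /\ s_input (ex i) = IEnter /\ s_time (ex i) <= t.

Definition left_by (ex : Execution) (t : R) (q : Node) : Prop :=
  exists i, s_input (ex i) = ILeave q /\ s_time (ex i) <= t.

Definition crashed_by (ex : Execution) (t : R) (q : Node) : Prop :=
  exists i, s_node (ex i) = q /\ s_input (ex i) = ICrash /\ s_time (ex i) <= t.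

Definition present ex S0 t q : Prop := entered_by ex S0 t q /\ ~ left_by ex t q.

Definition active ex S0 t q : Prop := present ex S0 t q /\ ~ crashed_by ex t q.

Definition entered_before (ex : Execution) (S0 : list Node) (i : nat) (q : Node) : Prop :=
  In q S0 \/ exists j, (j < i)%nat /\ s_node (ex j) = q /\ s_input (ex j) = IEnter.

Definition left_before (ex : Execution) (i : nat) (q : Node) : Prop :=
  exists j, (j < i)%nat /\ s_input (ex j) = ILeave q.

Definition crashed_before (ex : Execution) (i : nat) (q : Node) : Prop :=
  exists j, (j < i)%nat /\ s_node (ex j) = q /\ s_input (ex j) = ICrash.

Definition active_before ex S0 i q : Prop :=
  entered_before ex S0 i q /\ ~ left_before ex i q /\ ~ crashed_before ex i q.

Definition step_ok gamma S0 (ex : Execution) (i : nat) : Prop :=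
  let r := s_node (ex i) in
  match s_input (ex i) with
  | IEnter => ~ In r S0 /\
      ~ (exists j, (j < i)%nat /\ s_node (ex j) = r /\ s_input (ex j) = IEnter)
  | ILeave q => active_before ex S0 i r /\
      (q = r \/ (q <> r /\ entered_before ex S0 i q /\ ~ left_before ex i q
                 /\ crashed_before ex i q))
  | ICrash => active_before ex S0 i r
  | IRecv j => (j < i)%nat /\ broadcast gamma S0 ex j <> None /\
               s_node (ex j) <> r /\ active_before ex S0 i r
  | IIdle => True
  end.

Definition valid_execution (gamma : R) (S0 : list Node) (D : R) (ex : Execution) : Prop :=
  NoDup S0 /\
  (forall i, 0 <= s_time (ex i)) /\
  (forall i j, (i <= j)%nat -> s_time (ex i) <= s_time (ex j)) /\
  (forall T, exists i, T < s_time (ex i)) /\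
  (forall i, step_ok gamma S0 ex i) /\
  (forall i k j, s_input (ex i) = IRecv j -> s_input (ex k) = IRecv j ->
                 s_node (ex i) = s_node (ex k) -> i = k) /\
  (forall j1 j2 i1 i2, s_node (ex j1) = s_node (ex j2) -> (j1 < j2)%nat ->
     s_input (ex i1) = IRecv j1 -> s_input (ex i2) = IRecv j2 ->
     s_node (ex i1) = s_node (ex i2) -> (i1 < i2)%nat) /\
  (forall j m q, broadcast gamma S0 ex j = Some m -> q <> s_node (ex j) ->
     (forall t, s_time (ex j) <= t <= s_time (ex j) + D -> active ex S0 t q) ->
     exists i, s_node (ex i) = q /\ s_input (ex i) = IRecv j /\
               s_time (ex i) <= s_time (ex j) + D).

Definition NumPresent (ex : Execution) (S0 : list Node) (t : R) (n : nat) : Prop :=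
  exists l, NoDup l /\ (forall q, In q l <-> present ex S0 t q) /\ length l = n.

Definition churn_in (ex : Execution) (t1 t2 : R) (q : Node) : Prop :=
  exists i, t1 <= s_time (ex i) <= t2 /\
    ((s_node (ex i) = q /\ s_input (ex i) = IEnter) \/ s_input (ex i) = ILeave q).

Definition env_assumptions (ex : Execution) (S0 : list Node) (D alpha Delta : R)
  (Nmin : nat) : Prop :=
  (forall t n, 0 <= t -> NumPresent ex S0 t n -> (Nmin <= n)%nat) /\
  (forall t n l, 0 <= t -> NumPresent ex S0 t n -> NoDup l ->
     (forall q, In q l -> churn_in ex t (t + D) q) ->
     INR (length l) <= alpha * INR n) /\
  (forall t n l, 0 <= t -> NumPresent ex S0 t n -> NoDup l ->
     (forall q, In q l -> present ex S0 t q /\ crashed_by ex t q) ->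
     INR (length l) <= Delta * INR n).

(* Main.v *)
(** A node q that has joined knows every enter and leave event that happened more than 2D before
its current time.  When an entering node p hears its first joined echo, sent by such a q at time t,
put b = max(0, t - 2D): p then counts as present only nodes that were present at b or churned in
[b, b + 3D], and at least those present at b that do not churn in this window.  The upper bound on
gamma makes the nodes active throughout the window numerous enough to fill the join bound, so p
joins within 2D of entering.  The lower bound on gamma makes the echoes collected before joining
more numerous than the nodes that churned or crashed, so one of them comes from a node that was
active for D after any given event of [b, t_e]; through it p learns of that event, which is the
claim for p.  Both claims are proved by a simultaneous strong induction on the step number. *)

Require Import Defs.
From Stdlib Require Import Reals Lra Lia List Arith Bool Classical.
Import ListNotations.
Open Scope R_scope.

(** * Event lists and the events carried by messages *)

Lemma in_add_ev (e x : Ev) (c : list Ev) : In x (add_ev e c) <-> x = e \/ In x c.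
Proof.
  unfold add_ev; destruct (in_dec ev_eq_dec e c) as [H|H].
  - split; [tauto | intros [->|]; assumption].
  - rewrite in_app_iff; simpl; intuition congruence.
Qed.

Lemma in_union_ev (x : Ev) (c d : list Ev) : In x (union_ev c d) <-> In x c \/ In x d.
Proof.
  unfold union_ev; revert c; induction d as [|e d IH]; intros c; simpl.
  - tauto.
  - rewrite IH, in_add_ev; intuition congruence.
Qed.

Lemma in_present_set (q : Node) (c : list Ev) :
  In q (present_set c) <-> In (EvEnter q) c /\ ~ In (EvLeave q) c.
Proof.
  unfold present_set; rewrite nodup_In, in_flat_map; split.
  - intros [[r|r|r] [Hr Hq]]; try contradiction.
    destruct (in_dec ev_eq_dec (EvLeave r) c) as [|n]; [contradiction|].
    destruct Hq as [->|[]]; tauto.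
  - intros [He Hl]; exists (EvEnter q); split; [assumption|].
    destruct (in_dec ev_eq_dec (EvLeave q) c); [contradiction | left; reflexivity].
Qed.

Lemma NoDup_present_set (c : list Ev) : NoDup (present_set c).
Proof. apply NoDup_nodup. Qed.

(* [EvJoin] events never influence [present_set], so they are left out here. *)
Definition msg_events (m : Msg) : list Ev :=
  match m with
  | MEnter q | MJoined q | MJoinedEcho q => [EvEnter q]
  | MEnterEcho C _ _ => C
  | MLeave q | MLeaveEcho q => [EvLeave q]
  end.

(** Covers only events produced by a signal of the adversary. The entries of [S0] have no step of
    their own, so [knows] treats them separately. *)
Definition step_event (ex : Execution) (n : nat) (e : Ev) : Prop :=
  (s_input (ex n) = IEnter /\ e = EvEnter (s_node (ex n))) \/
  (exists q, s_input (ex n) = ILeave q /\ e = EvLeave q).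

Definition event_before (ex : Execution) (S0 : list Node) (n : nat) (e : Ev) : Prop :=
  match e with
  | EvEnter q => entered_before ex S0 n q
  | EvLeave q => left_before ex n q
  | EvJoin _ => True
  end.

(** * Local effect of a single transition *)

Ltac trans_cases :=
  unfold trans, set_changes;
  repeat match goal with
  | |- context [match ?x with _ => _ end] => destruct x eqn:?
  end; simpl.

Section Transition.
Context (gamma : R) (p : Node).

Lemma trans_changes_incl (s : LState) (inp : LInput) (e : Ev) :
  In e (changes s) -> In e (changes (fst (trans gamma p s inp))).
Proof.
  intros H; trans_cases; repeat rewrite in_add_ev; repeat rewrite in_union_ev; tauto.
Qed.

Lemma trans_recv_incl (s : LState) (m : Msg) (e : Ev) :
  In e (msg_events m) -> In e (changes (fst (trans gamma p s (LRecv m)))).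
Proof.
  intros H; trans_cases; repeat rewrite in_add_ev; repeat rewrite in_union_ev;
    simpl in H; intuition.
Qed.

Lemma trans_changes_inv (s : LState) (inp : LInput) (e : Ev) :
  In e (changes (fst (trans gamma p s inp))) ->
  In e (changes s) \/
  (inp = LEnter /\ e = EvEnter p) \/
  (exists q, inp = LLeave q /\ e = EvLeave q) \/
  (exists m, inp = LRecv m /\ In e (msg_events m)) \/
  (exists q, e = EvJoin q).
Proof.
  trans_cases; repeat rewrite in_add_ev; repeat rewrite in_union_ev;
    intros H; repeat destruct H as [H|H]; subst; eauto 8;
    right; right; right; left; eexists; split; try reflexivity; simpl; tauto.
Qed.

Lemma trans_joined_mono (s : LState) (inp : LInput) :
  is_joined s = true -> is_joined (fst (trans gamma p s inp)) = true.
Proof. intros H; trans_cases; try assumption; rewrite H in *; discriminate. Qed.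

Lemma trans_bound_mono (s : LState) (inp : LInput) :
  bound_set s = true -> bound_set (fst (trans gamma p s inp)) = true.
Proof. intros H; trans_cases; try assumption; rewrite H in *; reflexivity. Qed.

Definition echo_input (inp : LInput) : bool :=
  match inp with LRecv (MEnterEcho _ _ q) => Nat.eqb q p | _ => false end.

Lemma trans_not_echo (s : LState) (inp : LInput) :
  echo_input inp = false ->
  let s' := fst (trans gamma p s inp) in
  is_joined s' = is_joined s /\ join_counter s' = join_counter s /\
  join_bound s' = join_bound s /\ bound_set s' = bound_set s.
Proof.
  intros H; simpl; trans_cases; simpl in H; try tauto;
    rewrite H, andb_false_r in *; discriminate.
Qed.

Lemma trans_echo (s : LState) (C : list Ev) (f : bool) :
  is_joined s = false ->
  let s' := fst (trans gamma p s (LRecv (MEnterEcho C f p))) in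
  join_counter s' = S (join_counter s) /\
  bound_set s' = bound_set s || f /\
  join_bound s' = (if f && negb (bound_set s)
                   then gamma * INR (length (present_set (union_ev (changes s) C)))
                   else join_bound s) /\
  (is_joined s' = true <-> join_bound s' <= INR (join_counter s') /\ 0 < join_bound s').
Proof.
  intros H; unfold trans. rewrite H, Nat.eqb_refl; cbv beta iota zeta; simpl negb; simpl andb.
  cbv iota.
  destruct (Rle_dec _ _) as [a|a]; [destruct (Rlt_dec _ _) as [b|b]|]; cbn [fst join_counter bound_set join_bound is_joined];
    (split; [reflexivity|split; [reflexivity|split; [reflexivity|]]]); 
    (split; [try discriminate; auto | intros [? ?]; try reflexivity; contradiction]).
Qed.

Lemma trans_out_enter (s : LState) (inp : LInput) (q : Node) :
  snd (trans gamma p s inp) = Some (MEnter q) -> inp = LEnter /\ q = p.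
Proof. trans_cases; intros H; inversion H; auto. Qed.

Lemma trans_out_echo (s : LState) (inp : LInput) (C : list Ev) (f : bool) (q : Node) :
  snd (trans gamma p s inp) = Some (MEnterEcho C f q) ->
  inp = LRecv (MEnter q) /\ C = add_ev (EvEnter q) (changes s) /\ f = is_joined s.
Proof. trans_cases; intros H; inversion H; auto. Qed.

(** A sender records what it announces. The exception is a joining node: its [MJoined] announces its
    own entry, while the transition itself only adds [EvJoin p]. *)
Lemma trans_out_events (s : LState) (inp : LInput) (m : Msg) (e : Ev) :
  snd (trans gamma p s inp) = Some m -> In e (msg_events m) ->
  In e (changes (fst (trans gamma p s inp))) \/
  (e = EvEnter p /\ exists m', inp = LRecv m').
Proof.
  trans_cases; intros H; inversion H; subst m; simpl; repeat rewrite in_add_ev;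
    repeat rewrite in_union_ev; intros He; intuition (subst; eauto).
Qed.

End Transition.

(** * Counting nodes under bounded churn *)

(** The selection is classical because presence and crashes quantify over all steps of an infinite
    execution. *)
Lemma sublist_of_prop (P : Node -> Prop) (l : list Node) :
  exists l', NoDup l' /\ forall q, In q l' <-> In q l /\ P q.
Proof.
  induction l as [|a l (l' & Hl & IH)].
  - exists []; split; [constructor | simpl; tauto].
  - destruct (classic (P a)) as [Ha|Ha].
    + destruct (in_dec Nat.eq_dec a l') as [Hin|Hin].
      * exists l'; split; [assumption|]; intros q; rewrite IH; simpl.
        apply IH in Hin; intuition (subst; tauto).
      * exists (a :: l'); split; [constructor; assumption|].
        intros q; simpl; rewrite IH; intuition (subst; tauto).
    + exists l'; split; [assumption|]; intros q; rewrite IH; simpl; intuition (subst; tauto).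
Qed.

(** Both sides count the intersection of [P] and [C]. *)
Lemma length_filter_in (P C : list Node) :
  NoDup P -> NoDup C ->
  let inb l x := if in_dec Nat.eq_dec x l then true else false in
  length (filter (inb C) P) = length (filter (inb P) C).
Proof.
  intros HP HC inb.
  assert (W : forall A B, NoDup A ->
            (length (filter (inb B) A) <= length (filter (inb A) B))%nat).
  { intros A B HA; apply NoDup_incl_length; [apply NoDup_filter; assumption|].
    intros x; rewrite !filter_In; unfold inb.
    destruct (in_dec Nat.eq_dec x A), (in_dec Nat.eq_dec x B); intuition discriminate. }
  apply Nat.le_antisymm; apply W; assumption.
Qed.

Section Churn.
Context (alpha Delta gamma D : R) (Nmin : nat) (S0 : list Node) (ex : Execution).
Context (HD : 0 < D) (Ha0 : 0 <= alpha) (HDel0 : 0 <= Delta).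
Context (Hex : valid_execution gamma S0 D ex)
        (Henv : env_assumptions ex S0 D alpha Delta Nmin).

(** Times are monotone and unbounded, so only finitely many steps happen by [T]; together with [S0]
    they name every candidate. *)
Lemma enumerate (P : Node -> Prop) (T : R) :
  (forall q, P q -> entered_by ex S0 T q \/ churn_in ex 0 T q) ->
  exists l, NoDup l /\ forall q, In q l <-> P q.
Proof.
  intros HP.
  destruct Hex as (_ & _ & Hmono & Hunb & _).
  destruct (Hunb T) as [M HM].
  destruct (sublist_of_prop P
    (S0 ++ flat_map (fun i => s_node (ex i) ::
               match s_input (ex i) with ILeave q => [q] | _ => [] end) (seq 0 M)))
    as (l & Hl & Hin).
  exists l; split; [assumption|]; intros q; rewrite Hin; split; [tauto|].
  intros Hq; split; [|assumption]; rewrite in_app_iff, in_flat_map.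
  assert (HT : forall i, s_time (ex i) <= T -> In i (seq 0 M)).
  { intros i Hi; apply in_seq; destruct (Nat.lt_ge_cases i M) as [|G]; [lia|].
    apply Hmono in G; lra. }
  destruct (HP q Hq) as [[H|(i & Hn & Hi & Ht)]|(i & [_ Ht] & [[Hn Hi]|Hi])].
  - left; assumption.
  - right; exists i; split; [auto | left; assumption].
  - right; exists i; split; [auto | left; assumption].
  - right; exists i; split; [auto | right; rewrite Hi; left; reflexivity].
Qed.

Lemma enumerate_present (t : R) : exists l, NoDup l /\ forall q, In q l <-> present ex S0 t q.
Proof. apply enumerate with t; intros q [H _]; auto. Qed.

Lemma enumerate_churn (a t : R) :
  exists l, NoDup l /\ forall q, In q l <-> churn_in ex a t q.
Proof.
  apply enumerate with t; intros q (i & Ht & H); right; exists i; split; [|assumption].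
  split; [apply Hex | lra].
Qed.

Lemma present_later (b t : R) (q : Node) :
  b <= t -> present ex S0 t q -> present ex S0 b q \/ churn_in ex b t q.
Proof.
  intros Hbt [He Hl].
  assert (Hl' : ~ left_by ex b q) by (intros (i & ? & ?); apply Hl; exists i; intuition lra).
  destruct He as [H|(i & Hn & Hi & Ht)].
  - left; split; [left|]; assumption.
  - destruct (Rle_lt_dec b (s_time (ex i))).
    + right; exists i; intuition.
    + left; split; [right; exists i; intuition lra | assumption].
Qed.

Lemma present_stays (b t : R) (q : Node) :
  b <= t -> present ex S0 b q -> ~ churn_in ex b t q -> present ex S0 t q.
Proof.
  intros Hbt [He Hl] Hc; split.
  - destruct He as [|(i & ? & ? & ?)]; [left; auto | right; exists i; intuition lra].
  - intros (i & Hi & Ht); destruct (Rle_lt_dec b (s_time (ex i))).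
    + apply Hc; exists i; intuition.
    + apply Hl; exists i; intuition lra.
Qed.

(** A node present at [t] but not at [b] entered in between, so only the churning nodes outside [P]
    can enlarge the count. *)
Lemma present_card_later (b t : R) (P C Q : list Node) :
  b <= t -> (forall q, In q P <-> present ex S0 b q) ->
  (forall q, In q C <-> churn_in ex b t q) ->
  NoDup Q -> (forall q, In q Q <-> present ex S0 t q) ->
  (length Q <= length P +
     length (filter (fun q => negb (if in_dec Nat.eq_dec q P then true else false)) C))%nat.
Proof.
  intros Hbt HP HC HQ HQp; rewrite <- length_app; apply NoDup_incl_length; [assumption|].
  intros q Hq; rewrite in_app_iff, filter_In.
  destruct (in_dec Nat.eq_dec q P) as [|n]; [auto|right; split; [|reflexivity]].
  rewrite HC; apply HQp, (present_later b t) in Hq as [Hq|]; [|assumption|assumption].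
  exfalso; apply n, HP; assumption.
Qed.

(** The window is cut into blocks of length [D]; each block multiplies the population by at most
    [1 + alpha], and its churn is at most [alpha] times the population at its start. The index is
    [S k] because the degenerate window [[b, b]] may already contain churn. *)
Lemma churn_growth (b : R) (P : list Node) (k : nat) :
  0 <= b -> NoDup P -> (forall q, In q P <-> present ex S0 b q) ->
  forall C, NoDup C -> (forall q, In q C <-> churn_in ex b (b + INR (S k) * D) q) ->
  INR (length C) <= ((1 + alpha) ^ S k - 1) * INR (length P).
Proof.
  intros Hb HP HPp; destruct Henv as (_ & Hch & _).
  induction k as [|k IH]; intros C HC HCp.
  - replace (b + INR 1 * D) with (b + D) in HCp by (simpl; lra).
    replace ((1 + alpha) ^ 1 - 1) with alpha by ring.
    apply (Hch b (length P) C); auto; [exists P; auto | intros q; apply HCp].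
  - set (t := b + INR (S k) * D) in *.
    assert (Hbt : b <= t).
    { unfold t; pose proof (pos_INR (S k)); nra. }
    destruct (enumerate_churn b t) as (C1 & HC1 & HC1p).
    destruct (enumerate_churn t (t + D)) as (C2 & HC2 & HC2p).
    destruct (enumerate_present t) as (Q & HQ & HQp).
    assert (H1 : INR (length C1) <= ((1 + alpha) ^ S k - 1) * INR (length P)) by auto.
    assert (H2 : INR (length C2) <= alpha * INR (length Q)).
    { apply (Hch t (length Q) C2); [lra|exists Q; auto|auto|intros q; apply HC2p]. }
    assert (HQl : INR (length Q) <= INR (length P) + INR (length C1)).
    { rewrite <- plus_INR; apply le_INR; rewrite <- length_app.
      apply NoDup_incl_length; [assumption|]; intros q Hq; rewrite in_app_iff, HPp, HC1p.
      apply present_later; [|apply HQp]; assumption. }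
    assert (HCl : INR (length C) <= INR (length C1) + INR (length C2)).
    { rewrite <- plus_INR; apply le_INR; rewrite <- length_app.
      apply NoDup_incl_length; [assumption|]; intros q Hq; rewrite in_app_iff, HC1p, HC2p.
      apply HCp in Hq as (i & [Hi1 Hi2] & Hi).
      replace (b + INR (S (S k)) * D) with (t + D) in Hi2
        by (unfold t; rewrite (S_INR (S k)); ring).
      destruct (Rle_lt_dec (s_time (ex i)) t); [left|right]; exists i; intuition lra. }
    replace ((1 + alpha) ^ S (S k)) with ((1 + alpha) * (1 + alpha) ^ S k) by (simpl; ring).
    nra.
Qed.

(* Counts over the window [b, b + 3 D]: [e] is the number of entering nodes, [l] the number of
   churning nodes already present at [b]. *)
Lemma window (b : R) :
  0 <= b ->
  exists (N e l : R) (U W V B : list Node),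
    INR Nmin <= N /\ 0 <= e /\ 0 <= l /\ e + l <= ((1 + alpha) ^ 3 - 1) * N /\
    (forall q, present ex S0 b q \/ churn_in ex b (b + 3 * D) q -> In q U) /\
    INR (length U) = N + e /\
    NoDup W /\
    (forall q, In q W <-> present ex S0 b q /\ ~ churn_in ex b (b + 3 * D) q) /\
    N - l <= INR (length W) /\
    NoDup V /\
    (forall q, In q V <-> (present ex S0 b q /\ ~ churn_in ex b (b + 3 * D) q) /\
                          ~ crashed_by ex (b + 3 * D) q) /\
    N - l - Delta * (N + e) <= INR (length V) /\
    (forall q, churn_in ex b (b + 4 * D) q \/
       (present ex S0 (b + 3 * D) q /\ crashed_by ex (b + 3 * D) q) -> In q B) /\
    INR (length B) <= ((1 + alpha) ^ 4 - 1) * N + Delta * (N + e).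
Proof.
  intros Hb.
  destruct (enumerate_present b) as (P & HP & HPp).
  destruct (enumerate_churn b (b + 3 * D)) as (C & HC & HCp).
  destruct (enumerate_churn b (b + 4 * D)) as (C4 & HC4 & HC4p).
  destruct (enumerate_present (b + 3 * D)) as (Q & HQ & HQp).
  destruct (sublist_of_prop (crashed_by ex (b + 3 * D)) Q) as (X & HX & HXp).
  assert (HC3 : INR (length C) <= ((1 + alpha) ^ 3 - 1) * INR (length P)).
  { apply (churn_growth b P 2); auto; intros q; rewrite HCp.
    replace (INR 3) with 3 by (simpl; lra); reflexivity. }
  assert (HC4l : INR (length C4) <= ((1 + alpha) ^ 4 - 1) * INR (length P)).
  { apply (churn_growth b P 3); auto; intros q; rewrite HC4p.
    replace (INR 4) with 4 by (simpl; lra); reflexivity. }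
  pose (inb := fun l x => if in_dec Nat.eq_dec (x : Node) l then true else false).
  assert (inb_iff : forall l x, inb l x = true <-> In x l).
  { intros l x; unfold inb; destruct (in_dec _ _ _); intuition discriminate. }
  pose (E := filter (fun q => negb (inb P q)) C).
  pose (L := filter (inb P) C).
  pose (W := filter (fun q => negb (inb C q)) P).
  pose (V := filter (fun q => negb (inb X q)) W).
  assert (HEL : (length L + length E)%nat = length C) by apply filter_length.
  assert (HLW : (length L + length W)%nat = length P).
  { unfold L; replace (length (filter (inb P) C)) with (length (filter (inb C) P))
      by (apply length_filter_in; assumption); apply filter_length. }
  assert (HQl : (length Q <= length P + length E)%nat)
    by (apply (present_card_later b (b + 3 * D)); auto; lra).
  (* Crashes are permanent, so the failure bound at the single time [b + 3 * D] covers every crash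
     of a node still present at the end of the window. *)
  assert (HXl : INR (length X) <= Delta * INR (length Q)).
  { destruct Henv as (_ & _ & Hcr); apply (Hcr (b + 3 * D)); [lra|exists Q; auto|auto|].
    intros q Hq; apply HXp in Hq as [Hq Hc]; split; [apply HQp|]; assumption. }
  assert (HNW : NoDup W) by (apply NoDup_filter; assumption).
  assert (HVl : (length W <= length V + length X)%nat).
  { rewrite <- length_app; apply NoDup_incl_length; [assumption|].
    intros q Hq; rewrite in_app_iff; unfold V; rewrite filter_In, negb_true_iff.
    destruct (inb X q) eqn:Eq; [apply inb_iff in Eq|]; auto. }
  assert (HWp : forall q, In q W <-> present ex S0 b q /\ ~ churn_in ex b (b + 3 * D) q).
  { intros q; unfold W; rewrite filter_In, negb_true_iff, <- HPp, <- HCp, <- (inb_iff C).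
    destruct (inb C q); intuition congruence. }
  apply le_INR in HQl, HVl; rewrite plus_INR in HQl, HVl.
  apply (f_equal INR) in HEL, HLW; rewrite plus_INR in HEL, HLW.
  exists (INR (length P)), (INR (length E)), (INR (length L)), (P ++ E), W, V, (C4 ++ X).
  assert (HXQ : INR (length X) <= Delta * (INR (length P) + INR (length E))) by nra.
  repeat match goal with |- _ /\ _ => split end; try apply pos_INR; try lra; auto.
  - apply le_INR; destruct Henv as (Hn & _); apply (Hn b); [lra | exists P; auto].
  - intros q Hq; rewrite in_app_iff; unfold E; rewrite filter_In, negb_true_iff, HCp.
    destruct (inb P q) eqn:Eq; [apply inb_iff in Eq; auto|].
    destruct Hq as [Hq|]; [left; apply HPp|]; auto.
  - rewrite length_app, plus_INR; reflexivity.
  - apply NoDup_filter; assumption.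
  - intros q; unfold V; rewrite filter_In, negb_true_iff, HWp; split.
    + intros [Hw H3]; split; [exact Hw|]; destruct Hw as [H1 H2]; intros Hc.
      assert (Hx : In q X).
      { apply HXp; split; [|assumption]; apply HQp, present_stays with b; auto; lra. }
      apply inb_iff in Hx; congruence.
    + intros [Hw Hc]; split; [assumption|].
      destruct (inb X q) eqn:Eq; [|reflexivity]; apply inb_iff, HXp in Eq; tauto.
  - intros q Hq; rewrite in_app_iff, HC4p, HXp, HQp; tauto.
  - rewrite length_app, plus_INR; lra.
Qed.

End Churn.

(** * Consequences of the assumptions on the constants *)

Section Constants.
Context (alpha Delta gamma M : R).
Context (Ha0 : 0 <= alpha) (Ha1 : alpha < 1) (HDel0 : 0 <= Delta) (HM0 : 0 <= M).
Context (HN : 1 < ((1 - alpha) ^ 3 - Delta * (1 + alpha) ^ 3) * M).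
Context (Hg1 : 1 / (M * (1 - alpha) ^ 3)
         + (1 + Delta) * ((1 + alpha) ^ 3 / (1 - alpha) ^ 3) - 1 <= gamma).
Context (Hg2 : gamma <= (1 - alpha) ^ 3 / (1 + alpha) ^ 3 - Delta).

Lemma pow3_bounds :
  0 < (1 - alpha) ^ 3 /\ (1 - alpha) ^ 3 <= 1 /\ 1 <= (1 + alpha) ^ 3.
Proof.
  repeat split.
  - apply pow_lt; lra.
  - rewrite <- (pow1 3); apply pow_incr; lra.
  - apply pow_R1_Rle; lra.
Qed.

Lemma M_pos : 0 < M.
Proof.
  destruct (Rle_lt_or_eq_dec 0 M HM0) as [|E]; [assumption | rewrite <- E in HN; lra].
Qed.

Lemma gamma_lower :
  / M + (1 + Delta) * (1 + alpha) ^ 3 - (1 - alpha) ^ 3 <= gamma * (1 - alpha) ^ 3.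
Proof.
  destruct pow3_bounds as (Hy & _ & _); pose proof M_pos.
  eapply Rle_trans;
    [|exact (Rmult_le_compat_r ((1 - alpha) ^ 3) _ _ (Rlt_le _ _ Hy) Hg1)].
  right; field; lra.
Qed.

Lemma gamma_upper : (gamma + Delta) * (1 + alpha) ^ 3 <= (1 - alpha) ^ 3.
Proof.
  destruct pow3_bounds as (Hy & _ & Hx).
  replace ((1 - alpha) ^ 3) with ((1 - alpha) ^ 3 / (1 + alpha) ^ 3 * (1 + alpha) ^ 3)
    by (field; lra).
  apply Rmult_le_compat_r; lra.
Qed.

Lemma gamma_le_1 : gamma <= 1.
Proof. destruct pow3_bounds as (Hy & Hy1 & Hx); pose proof gamma_upper; nra. Qed.

Lemma gamma_pos : 0 < gamma.
Proof.
  destruct pow3_bounds as (Hy & Hy1 & Hx); pose proof gamma_lower.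
  assert (0 < / M) by (apply Rinv_0_lt_compat, M_pos).
  assert (0 < gamma * (1 - alpha) ^ 3) by nra; nra.
Qed.

(* Compatibility of the two bounds on [gamma] forces [(1 + alpha)^3 <= 2 (1 - alpha)^3]. *)
Lemma alpha_small : alpha <= 12 / 100.
Proof.
  destruct pow3_bounds as (Hy & Hy1 & Hx); pose proof gamma_lower as Hl.
  pose proof gamma_le_1.
  assert (0 < / M) by (apply Rinv_0_lt_compat, M_pos).
  assert (H2 : (1 + alpha) ^ 3 <= 2 * (1 - alpha) ^ 3) by nra.
  (* Equality in [H2] occurs near 0.115; 12/100 is a convenient value above it. *)
  destruct (Rle_lt_dec alpha (12 / 100)) as [|Hlt]; [assumption|exfalso].
  assert ((1 + 12 / 100) ^ 3 <= (1 + alpha) ^ 3) by (apply pow_incr; lra).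
  assert ((1 - alpha) ^ 3 <= (1 - 12 / 100) ^ 3) by (apply pow_incr; lra).
  lra.
Qed.

(** The left side bounds the join threshold from above, the right side bounds the active survivors
    from below. Entering and leaving nodes share the budget [e + l]; since [gamma + Delta <= 1], the
    worst case is [e = 0], which is [Hw]. Charging the full budget to both would not fit the upper
    bound on [gamma]. *)
Lemma survivors_exceed_bound (N e l : R) :
  0 <= N -> 0 <= e -> e + l <= ((1 + alpha) ^ 3 - 1) * N ->
  gamma * (N + e) <= N - l - Delta * (N + e).
Proof.
  intros HN0 He Hel.
  destruct pow3_bounds as (Hy & Hy1 & Hx); pose proof gamma_upper; pose proof gamma_pos.
  pose proof alpha_small.
  assert (Hw : gamma + Delta + (1 + alpha) ^ 3 <= 2).
  { assert ((1 - alpha) ^ 3 <= (2 - (1 + alpha) ^ 3) * (1 + alpha) ^ 3).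
    { assert (0 <= alpha * (2 - 12 * alpha)) by nra.
      assert (0 <= alpha ^ 2 <= 2/100) by nra.
      assert (0 <= alpha ^ 3) by (apply pow_le; lra).
      assert (alpha ^ 3 <= alpha * (2/100)) by nra.
      nra. }
    nra. }
  nra.
Qed.

(** Here [e] and [l] may each be as large as the whole churn budget, so [N - l] is replaced by
    [(2 - (1 + alpha) ^ 3) * N]. The fourth block of churn costs an extra [alpha * (1 + alpha) ^ 3],
    which [Hpoly] absorbs; strictness comes from the term [/ M] in [gamma_lower]. *)
Lemma echoes_exceed_bad (N e l : R) :
  M <= N -> 0 <= e -> e + l <= ((1 + alpha) ^ 3 - 1) * N -> 0 <= l ->
  ((1 + alpha) ^ 4 - 1) * N + Delta * (N + e) < gamma * (N - l).
Proof.
  intros HNM He Hel Hl.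
  destruct pow3_bounds as (Hy & Hy1 & Hx); pose proof gamma_lower; pose proof gamma_pos.
  pose proof gamma_le_1; pose proof alpha_small; pose proof M_pos.
  assert (0 < / M) by (apply Rinv_0_lt_compat, M_pos).
  assert (Hpoly : alpha * (1 + alpha) ^ 3 <= 1 - (1 - alpha) ^ 3 - 6 * alpha ^ 2).
  { assert (0 <= alpha ^ 2 <= 2/100) by nra.
    assert (0 <= alpha ^ 3) by (apply pow_le; lra).
    assert (alpha ^ 3 <= alpha * (2/100)) by nra.
    nra. }
  assert (Hid : 2 - (1 + alpha) ^ 3 = (1 - alpha) ^ 3 - 6 * alpha ^ 2) by ring.
  assert (Hg : (1 + alpha) ^ 4 - 1 + Delta * (1 + alpha) ^ 3 < gamma * (2 - (1 + alpha) ^ 3)).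
  { rewrite Hid; replace ((1 + alpha) ^ 4) with ((1 + alpha) ^ 3 + alpha * (1 + alpha) ^ 3)
      by ring.
    assert (gamma * (6 * alpha ^ 2) <= 6 * alpha ^ 2) by nra.
    nra. }
  assert (Delta * (N + e) <= Delta * (1 + alpha) ^ 3 * N) by nra.
  assert (gamma * ((2 - (1 + alpha) ^ 3) * N) <= gamma * (N - l)) by nra.
  nra.
Qed.

End Constants.

(** * Executions *)

Section Execution.
Context (gamma : R) (S0 : list Node) (D : R) (ex : Execution).

Definition st (n : nat) (q : Node) : LState := fst (run gamma S0 ex n) q.

(** The message is looked up in [broadcast] rather than in the table of a finite run, so the input
    is independent of how far the run has been computed. *)
Definition linput (n : nat) : LInput :=
  match s_input (ex n) with
  | IEnter => LEnter
  | ILeave q => LLeave q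
  | ICrash => LCrash
  | IIdle => LNone
  | IRecv j => match broadcast gamma S0 ex j with Some m => LRecv m | None => LNone end
  end.

Lemma run_messages (n i : nat) :
  (i < n)%nat -> snd (run gamma S0 ex n) i = broadcast gamma S0 ex i.
Proof.
  induction n as [|n IH]; intros Hi; [lia|].
  destruct (Nat.eq_dec i n) as [->|Hne]; [reflexivity|].
  rewrite <- IH by lia.
  simpl run; destruct (run gamma S0 ex n) as [cf ms]; simpl.
  destruct (trans _ _ _ _) as [s' out]; simpl.
  destruct (Nat.eqb_spec i n); [contradiction | reflexivity].
Qed.

Context (Hex : valid_execution gamma S0 D ex).

Local Notation time n := (s_time (ex n)).
Local Notation node n := (s_node (ex n)).

Lemma time_nonneg (n : nat) : 0 <= time n.
Proof. apply Hex. Qed.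

Lemma time_mono (n m : nat) : (n <= m)%nat -> time n <= time m.
Proof. apply Hex. Qed.

Lemma time_lt (n m : nat) : time n < time m -> (n < m)%nat.
Proof.
  intros H; destruct (Nat.lt_ge_cases n m) as [|G]; [assumption|].
  apply time_mono in G; lra.
Qed.

Lemma valid_step (n : nat) : step_ok gamma S0 ex n.
Proof. apply Hex. Qed.

(** A valid receive step refers to an earlier broadcast, whose table entry is already final; hence
    the input used by [run] is [linput n]. *)
Lemma step_run (n : nat) :
  (forall q, st (S n) q = if Nat.eqb q (node n)
                          then fst (trans gamma (node n) (st n (node n)) (linput n))
                          else st n q) /\
  broadcast gamma S0 ex n = snd (trans gamma (node n) (st n (node n)) (linput n)).
Proof.
  assert (Hi : match s_input (ex n) with
               | IEnter => LEnter
               | ILeave q => LLeave q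
               | ICrash => LCrash
               | IIdle => LNone
               | IRecv j => match snd (run gamma S0 ex n) j with
                            | Some m => LRecv m | None => LNone end
               end = linput n).
  { unfold linput; pose proof (valid_step n) as Hok; unfold step_ok in Hok.
    destruct (s_input (ex n)); try reflexivity.
    rewrite run_messages; [reflexivity | tauto]. }
  unfold broadcast, st; rewrite <- Hi; clear Hi; simpl run.
  destruct (run gamma S0 ex n) as [cf ms]; cbn [fst snd].
  destruct (trans _ _ _ _) as [s' out]; cbn [fst snd].
  rewrite Nat.eqb_refl; auto.
Qed.

Lemma st_step_same (n : nat) :
  st (S n) (node n) = fst (trans gamma (node n) (st n (node n)) (linput n)).
Proof. rewrite (proj1 (step_run n)), Nat.eqb_refl; reflexivity. Qed.

Lemma st_step_other (n : nat) (q : Node) : q <> node n -> st (S n) q = st n q.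
Proof.
  intros H; rewrite (proj1 (step_run n)).
  destruct (Nat.eqb_spec q (node n)); [contradiction | reflexivity].
Qed.

Lemma changes_mono (n m : nat) (q : Node) (e : Ev) :
  (n <= m)%nat -> In e (changes (st n q)) -> In e (changes (st m q)).
Proof.
  induction 1 as [|m _ IH]; [tauto|]; intros H.
  rewrite (proj1 (step_run m)); destruct (Nat.eqb_spec q (node m)) as [->|]; [|auto].
  apply trans_changes_incl; auto.
Qed.

Lemma joined_mono (n m : nat) (q : Node) :
  (n <= m)%nat -> is_joined (st n q) = true -> is_joined (st m q) = true.
Proof.
  induction 1 as [|m _ IH]; [tauto|]; intros H.
  rewrite (proj1 (step_run m)); destruct (Nat.eqb_spec q (node m)) as [->|]; [|auto].
  apply trans_joined_mono; auto.
Qed.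

Lemma bound_mono (n m : nat) (q : Node) :
  (n <= m)%nat -> bound_set (st n q) = true -> bound_set (st m q) = true.
Proof.
  induction 1 as [|m _ IH]; [tauto|]; intros H.
  rewrite (proj1 (step_run m)); destruct (Nat.eqb_spec q (node m)) as [->|]; [|auto].
  apply trans_bound_mono; auto.
Qed.

Lemma linput_recv (n : nat) (m : Msg) :
  linput n = LRecv m ->
  exists j, s_input (ex n) = IRecv j /\ broadcast gamma S0 ex j = Some m /\ (j < n)%nat /\
            node j <> node n /\ active_before ex S0 n (node n).
Proof.
  unfold linput; intros H; pose proof (valid_step n) as Hok; unfold step_ok in Hok.
  destruct (s_input (ex n)) as [| | |j|]; try discriminate.
  destruct (broadcast gamma S0 ex j) eqn:E; [|discriminate].
  inversion H; subst; exists j; intuition.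
Qed.

Lemma recv_incl (n j : nat) (m : Msg) (e : Ev) :
  s_input (ex n) = IRecv j -> broadcast gamma S0 ex j = Some m -> In e (msg_events m) ->
  In e (changes (st (S n) (node n))).
Proof.
  intros H Hb He; rewrite st_step_same; unfold linput; rewrite H, Hb.
  apply trans_recv_incl; assumption.
Qed.

Lemma broadcast_enter (j : nat) (p : Node) :
  broadcast gamma S0 ex j = Some (MEnter p) -> s_input (ex j) = IEnter /\ node j = p.
Proof.
  rewrite (proj2 (step_run j)); intros H; apply trans_out_enter in H as [H ->].
  unfold linput in H; destruct (s_input (ex j)); try discriminate; auto.
  destruct (broadcast _ _ _ _); discriminate.
Qed.

Lemma broadcast_echo (j : nat) (C : list Ev) (f : bool) (p : Node) :
  broadcast gamma S0 ex j = Some (MEnterEcho C f p) ->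
  C = add_ev (EvEnter p) (changes (st j (node j))) /\ f = is_joined (st j (node j)) /\
  active_before ex S0 j (node j) /\
  exists i, s_input (ex j) = IRecv i /\ s_input (ex i) = IEnter /\ node i = p /\ (i < j)%nat.
Proof.
  rewrite (proj2 (step_run j)); intros H; apply trans_out_echo in H as (H & HC & Hf).
  apply linput_recv in H as (i & Hi & Hb & Hij & _ & Ha).
  apply broadcast_enter in Hb as [? ?]; eauto 10.
Qed.

Lemma enter_unique (i j : nat) :
  s_input (ex i) = IEnter -> s_input (ex j) = IEnter -> node i = node j -> i = j.
Proof.
  intros Hi Hj Hn.
  assert (W : forall a b, s_input (ex a) = IEnter -> s_input (ex b) = IEnter ->
            node a = node b -> ~ (a < b)%nat).
  { intros a b Ha Hb Hab L; pose proof (valid_step b) as Hok; unfold step_ok in Hok.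
    rewrite Hb in Hok; apply Hok; eauto. }
  destruct (Nat.lt_trichotomy i j) as [L|[E|L]]; [exfalso; apply (W i j)|assumption|exfalso; apply (W j i)]; auto.
Qed.

Lemma event_before_mono (n m : nat) (e : Ev) :
  (n <= m)%nat -> event_before ex S0 n e -> event_before ex S0 m e.
Proof.
  intros L; destruct e; simpl; auto.
  - intros [H|(j & Hj & H)]; [left; auto | right; exists j; split; [lia | auto]].
  - intros (j & Hj & H); exists j; split; [lia | auto].
Qed.

(** No node records an event that has not happened. A received event is traced to the state of its
    sender, hence the strong induction; for a node announcing its own entry when it joins, being
    able to receive shows that it had entered. *)
Lemma changes_sound (n : nat) (q : Node) (e : Ev) :
  In e (changes (st n q)) -> event_before ex S0 n e.
Proof.
  revert q e; induction n as [n IH] using lt_wf_ind; intros q e.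
  assert (Hmsg : forall j m e', (S j < n)%nat -> broadcast gamma S0 ex j = Some m ->
            In e' (msg_events m) -> event_before ex S0 n e').
  { intros j m e' Hj Hb He.
    rewrite (proj2 (step_run j)) in Hb.
    destruct (trans_out_events gamma (node j) _ _ _ _ Hb He) as [H|[-> [m' H]]].
    - rewrite <- st_step_same in H; apply event_before_mono with (S j); [lia|].
      eapply IH; eauto.
    - apply linput_recv in H as (i & _ & _ & _ & _ & H & _).
      apply (event_before_mono j n (EvEnter (node j))); [lia | exact H]. }
  destruct n as [|n].
  - unfold st; simpl; unfold init_state; destruct (in_dec Nat.eq_dec q S0); simpl; [|tauto].
    rewrite in_flat_map; intros (r & Hr & [<-|[<-|[]]]); simpl; auto; left; auto.
  - rewrite (proj1 (step_run n)); destruct (Nat.eqb_spec q (node n)) as [->|]; intros H.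
    2: apply event_before_mono with n; [lia | eapply IH; eauto].
    apply trans_changes_inv in H as [H|[[H ->]|[(r & H & ->)|[(m & H & He)|(r & ->)]]]].
    + apply event_before_mono with n; [lia | eapply IH; eauto].
    + right; exists n; unfold linput in H.
      destruct (s_input (ex n)) as [| | |j|] eqn:E; try discriminate; auto.
      destruct (broadcast _ _ _ _); discriminate.
    + exists n; unfold linput in H.
      destruct (s_input (ex n)) as [| | |j|] eqn:E; try discriminate.
      * inversion H; auto.
      * destruct (broadcast _ _ _ _); discriminate.
    + apply linput_recv in H as (j & _ & Hb & Hj & _).
      apply (Hmsg j m); auto; lia.
    + exact I.
Qed.

Lemma step_event_message (n : nat) (e : Ev) :
  step_event ex n e ->
  In e (changes (st (S n) (node n))) /\
  exists m, broadcast gamma S0 ex n = Some m /\ In e (msg_events m).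
Proof.
  intros H; rewrite st_step_same, (proj2 (step_run n)); unfold linput.
  destruct H as [[-> ->]|(q & -> & ->)]; simpl; rewrite in_add_ev;
    eauto 6 using in_eq.
Qed.

(** Receivers of an enter or leave message pass its event on. This second hop serves nodes that had
    not entered at the original broadcast. *)
Lemma step_event_relay (n k : nat) (e : Ev) :
  step_event ex n e -> s_input (ex k) = IRecv n ->
  In e (changes (st (S k) (node k))) /\
  exists m, broadcast gamma S0 ex k = Some m /\ In e (msg_events m).
Proof.
  intros H Hk; pose proof H as H'.
  apply step_event_message in H' as (_ & m & Hm & He).
  split; [eapply recv_incl; eauto|].
  rewrite (proj2 (step_run n)) in Hm.
  rewrite (proj2 (step_run k)); unfold linput; rewrite Hk, (proj2 (step_run n)).
  unfold linput.
  destruct H as [[-> ->]|(q & -> & ->)]; simpl; eexists; split; try reflexivity; simpl;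
    rewrite ?in_add_ev; auto.
Qed.

(** [active] refers to times and [active_before] to step numbers; the strict [u < time n] ensures
    that all steps up to time [u] precede step [n]. *)
Lemma active_of_before (n : nat) (q : Node) (t u : R) :
  entered_by ex S0 t q -> t <= u -> u < time n -> active_before ex S0 n q ->
  active ex S0 u q.
Proof.
  intros He Htu Hun (_ & Hl & Hc); split; [split|].
  - destruct He as [|(i & ? & ? & ?)]; [left; auto | right; exists i; intuition lra].
  - intros (i & Hi & Ht); apply Hl; exists i; split; [|assumption].
    apply time_lt; lra.
  - intros (i & Hn & Hi & Ht); apply Hc; exists i; split; [|auto].
    apply time_lt; lra.
Qed.

Lemma active_anti (q : Node) (t u v : R) :
  entered_by ex S0 t q -> t <= u <= v -> active ex S0 v q -> active ex S0 u q.
Proof.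
  intros He Htu [[_ Hl] Hc]; split; [split|].
  - destruct He as [|(i & ? & ? & ?)]; [left; auto | right; exists i; intuition lra].
  - intros (i & Hi & Ht); apply Hl; exists i; intuition lra.
  - intros (i & Hn & Hi & Ht); apply Hc; exists i; intuition lra.
Qed.

Lemma delivery (j : nat) (m : Msg) (q : Node) :
  broadcast gamma S0 ex j = Some m -> q <> node j ->
  (forall t, time j <= t <= time j + D -> active ex S0 t q) ->
  exists k, node k = q /\ s_input (ex k) = IRecv j /\ time k <= time j + D /\ (j < k)%nat.
Proof.
  intros Hb Hq Ha.
  destruct Hex as (_ & _ & _ & _ & _ & _ & _ & Hd).
  destruct (Hd j m q Hb Hq Ha) as (k & Hk & Hi & Ht); exists k; repeat split; auto.
  pose proof (valid_step k) as Hok; unfold step_ok in Hok; rewrite Hi in Hok; tauto.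
Qed.

Lemma recv_unique (i k j : nat) :
  s_input (ex i) = IRecv j -> s_input (ex k) = IRecv j -> node i = node k -> i = k.
Proof. apply Hex. Qed.

(* Either the receiver stays active for [D] and the message is delivered in time,
   or it is gone by then and cannot receive anything later. *)
Lemma recv_delay (j k : nat) (m : Msg) :
  s_input (ex k) = IRecv j -> broadcast gamma S0 ex j = Some m ->
  entered_by ex S0 (time j) (node k) -> time k <= time j + D.
Proof.
  intros Hk Hb He.
  pose proof (valid_step k) as Hok; unfold step_ok in Hok; rewrite Hk in Hok.
  destruct Hok as (Hjk & _ & Hne & Ha).
  destruct (Rle_lt_dec (time k) (time j + D)) as [|Hlt]; [assumption|].
  destruct (delivery j m (node k)) as (k' & Hn & Hi & Ht & _); auto.
  - intros t Ht; apply active_of_before with k (time j); auto; lra.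
  - replace k with k' by (eapply recv_unique; eauto); assumption.
Qed.

Lemma known_delivered (j n : nat) (m : Msg) (q : Node) (e : Ev) :
  broadcast gamma S0 ex j = Some m -> In e (msg_events m) -> q <> node j ->
  entered_by ex S0 (time j) q -> active_before ex S0 n q -> time j + D < time n ->
  In e (changes (st n q)).
Proof.
  intros Hb He Hq Hent Ha Ht.
  destruct (delivery j m q Hb Hq) as (k & Hn & Hi & Hk & _).
  - intros t Hj; apply active_of_before with n (time j); auto; lra.
  - subst q; apply changes_mono with (S k).
    + apply time_lt; lra.
    + eapply recv_incl; eauto.
Qed.

Lemma active_before_entry (n : nat) (p : Node) :
  ~ In p S0 -> active_before ex S0 n p ->
  exists i, (i < n)%nat /\ node i = p /\ s_input (ex i) = IEnter.
Proof. intros Hp [[H|H] _]; [contradiction | exact H]. Qed.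

(** ** Echoes and the join bound *)

Definition is_echo (p : Node) (k : nat) : bool :=
  Nat.eqb (node k) p && echo_input p (linput k).

Definition echoes (p : Node) (n : nat) : list nat := filter (is_echo p) (seq 0 n).

Definition sender (k : nat) : Node :=
  match s_input (ex k) with IRecv j => node j | _ => O end.

Lemma is_echo_spec (p : Node) (k : nat) :
  is_echo p k = true <->
  node k = p /\
  exists j C f, s_input (ex k) = IRecv j /\ broadcast gamma S0 ex j = Some (MEnterEcho C f p).
Proof.
  unfold is_echo; rewrite andb_true_iff, Nat.eqb_eq; split.
  - intros [Hn H]; split; [assumption|].
    destruct (linput k) as [| | |m|] eqn:E; try discriminate.
    destruct m; try discriminate; simpl in H; apply Nat.eqb_eq in H; subst.
    apply linput_recv in E as (j' & ? & ? & _); eauto.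
  - intros [Hn (j & C & f & Hi & Hb)]; split; [assumption|].
    unfold linput; rewrite Hi, Hb; simpl; apply Nat.eqb_refl.
Qed.

Lemma echoes_S (p : Node) (n : nat) :
  echoes p (S n) = echoes p n ++ (if is_echo p n then [n] else []).
Proof. unfold echoes; rewrite seq_S, filter_app; simpl; destruct (is_echo p n); reflexivity. Qed.

(** A node enters once, so there is one enter message for [p]; each node receives it, and so echoes
    it, at most once, and [p] receives each echo at most once. Hence counting echoes counts distinct
    nodes. *)
Lemma sender_inj (p : Node) (k1 k2 : nat) :
  is_echo p k1 = true -> is_echo p k2 = true -> sender k1 = sender k2 -> k1 = k2.
Proof.
  rewrite !is_echo_spec; intros (Hn1 & j1 & C1 & f1 & Hi1 & Hb1) (Hn2 & j2 & C2 & f2 & Hi2 & Hb2).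
  unfold sender; rewrite Hi1, Hi2; intros Hs.
  apply broadcast_echo in Hb1 as (_ & _ & _ & i1 & Hr1 & He1 & Hp1 & _).
  apply broadcast_echo in Hb2 as (_ & _ & _ & i2 & Hr2 & He2 & Hp2 & _).
  assert (i1 = i2) by (apply enter_unique; congruence); subst i2.
  assert (j1 = j2) by (eapply recv_unique; eauto); subst j2.
  eapply recv_unique; eauto; congruence.
Qed.

Lemma echoes_senders (p : Node) (n : nat) :
  NoDup (map sender (echoes p n)) /\ length (map sender (echoes p n)) = length (echoes p n).
Proof.
  split; [|apply length_map].
  unfold echoes; generalize (seq_NoDup n 0); generalize (seq 0 n); intros l Hl.
  induction Hl as [|k l Hk Hl IH]; simpl; [constructor|].
  destruct (is_echo p k) eqn:E; [|assumption]; simpl; constructor; [|assumption].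
  rewrite in_map_iff; intros (k' & Hs & Hin); apply filter_In in Hin as [Hin E'].
  apply Hk; replace k with k'; [assumption | eapply sender_inj; eauto].
Qed.

Lemma in_senders (p u : Node) (n : nat) :
  In u (map sender (echoes p n)) <->
  exists k j C f, (k < n)%nat /\ node k = p /\ s_input (ex k) = IRecv j /\ node j = u /\
     broadcast gamma S0 ex j = Some (MEnterEcho C f p).
Proof.
  rewrite in_map_iff; unfold echoes; split.
  - intros (k & Hs & Hk); apply filter_In in Hk as [Hk He].
    apply in_seq in Hk; apply is_echo_spec in He as (Hn & j & C & f & Hi & Hb).
    unfold sender in Hs; rewrite Hi in Hs; exists k, j, C, f; repeat split; auto; lia.
  - intros (k & j & C & f & Hk & Hn & Hi & Hu & Hb); exists k; split.
    + unfold sender; rewrite Hi; assumption.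
    + apply filter_In; split; [apply in_seq; lia | apply is_echo_spec; eauto 6].
Qed.

(** The state keeps only the value of the bound; the counting arguments also need the steps at which
    the deciding echo was sent and received. *)
Definition bound_origin (p : Node) (n : nat) : Prop :=
  exists k j C, (k < n)%nat /\ node k = p /\ s_input (ex k) = IRecv j /\
    broadcast gamma S0 ex j = Some (MEnterEcho C true p) /\
    join_bound (st n p)
    = gamma * INR (length (present_set (union_ev (changes (st k p)) C))).

(** Holds up to and including the joining step. Afterwards echoes may still arrive, but the counter
    stands still. *)
Definition join_inv (p : Node) (n : nat) : Prop :=
  join_counter (st n p) = length (echoes p n) /\
  (bound_set (st n p) = false -> join_bound (st n p) = 0) /\
  (bound_set (st n p) = true -> bound_origin p n).

Lemma not_echo_step (p : Node) (n : nat) :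
  is_echo p n = false ->
  is_joined (st (S n) p) = is_joined (st n p) /\
  join_counter (st (S n) p) = join_counter (st n p) /\
  join_bound (st (S n) p) = join_bound (st n p) /\
  bound_set (st (S n) p) = bound_set (st n p).
Proof.
  unfold is_echo; intros H; destruct (Nat.eqb_spec (node n) p) as [<-|Hne].
  - rewrite st_step_same; apply trans_not_echo; assumption.
  - rewrite st_step_other by congruence; auto.
Qed.

Lemma echo_step (p : Node) (n j : nat) (C : list Ev) (f : bool) :
  node n = p -> s_input (ex n) = IRecv j ->
  broadcast gamma S0 ex j = Some (MEnterEcho C f p) ->
  is_joined (st n p) = false ->
  join_counter (st (S n) p) = S (join_counter (st n p)) /\
  bound_set (st (S n) p) = bound_set (st n p) || f /\
  join_bound (st (S n) p) = (if f && negb (bound_set (st n p))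
                   then gamma * INR (length (present_set (union_ev (changes (st n p)) C)))
                   else join_bound (st n p)) /\
  (is_joined (st (S n) p) = true <->
   join_bound (st (S n) p) <= INR (join_counter (st (S n) p)) /\ 0 < join_bound (st (S n) p)).
Proof.
  intros <- Hi Hb Hj; rewrite st_step_same; unfold linput; rewrite Hi, Hb.
  apply trans_echo; assumption.
Qed.

Lemma bound_origin_S (p : Node) (n : nat) :
  join_bound (st (S n) p) = join_bound (st n p) -> bound_origin p n -> bound_origin p (S n).
Proof.
  intros H (k & j & C & Hk & Hn & Hi & Hb & Hj); exists k, j, C; rewrite H.
  repeat split; auto; lia.
Qed.

Lemma join_inv_step (p : Node) (n : nat) :
  is_joined (st n p) = false -> join_inv p n -> join_inv p (S n).
Proof.
  intros Hj (Hc & H0 & Ho); unfold join_inv; rewrite echoes_S, length_app.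
  destruct (is_echo p n) eqn:E.
  - apply is_echo_spec in E as (Hn & j & C & f & Hi & Hb).
    destruct (echo_step p n j C f Hn Hi Hb Hj) as (E1 & E2 & E3 & _).
    rewrite E1, E2, Hc; simpl; repeat split; [lia| |].
    + rewrite orb_false_iff; intros [Hs ->]; rewrite E3; simpl; auto.
    + intros Hs; destruct (bound_set (st n p)) eqn:Eb.
      * rewrite andb_false_r in E3; apply bound_origin_S; auto.
      * simpl in Hs; subst f; exists n, j, C; repeat split; auto.
  - destruct (not_echo_step p n E) as (_ & -> & E3 & ->); simpl; rewrite E3, Hc.
    repeat split; [lia | auto |].
    intros Hs; apply bound_origin_S; auto.
Qed.

(** Only echo steps change the counter or the bound, and each of them performs the join test, so a
    node that has not joined has failed its latest test. *)
Lemma join_inv_before (p : Node) (n : nat) :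
  ~ In p S0 -> is_joined (st n p) = false ->
  join_inv p n /\
  (0 < join_bound (st n p) -> INR (join_counter (st n p)) < join_bound (st n p)).
Proof.
  intros Hp; induction n as [|n IH]; intros Hj.
  - unfold join_inv, st; simpl; unfold init_state.
    destruct (in_dec Nat.eq_dec p S0); [contradiction|]; simpl.
    repeat split; auto; try discriminate.
  - assert (Hj' : is_joined (st n p) = false).
    { destruct (is_joined (st n p)) eqn:E; [|reflexivity].
      rewrite (joined_mono n (S n) p) in Hj; auto. }
    destruct (IH Hj') as [Hinv Hlt]; split; [apply join_inv_step; assumption|].
    destruct (is_echo p n) eqn:E.
    + apply is_echo_spec in E as (Hn & j & C & f & Hi & Hb).
      destruct (echo_step p n j C f Hn Hi Hb Hj') as (_ & _ & _ & Hiff).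
      intros Hpos; apply Rnot_le_lt; intros Hle.
      assert (is_joined (st (S n) p) = true) by (apply Hiff; auto); congruence.
    + destruct (not_echo_step p n E) as (_ & -> & -> & _); exact Hlt.
Qed.

Lemma join_step (p : Node) (n : nat) :
  ~ In p S0 -> is_joined (st n p) = true ->
  exists k, (k < n)%nat /\ node k = p /\ active_before ex S0 k p /\
    is_joined (st k p) = false /\ bound_origin p (S k) /\
    join_bound (st (S k) p) <= INR (length (echoes p (S k))).
Proof.
  intros Hp; induction n as [|n IH]; intros Hj.
  - unfold st in Hj; simpl in Hj; unfold init_state in Hj.
    destruct (in_dec Nat.eq_dec p S0); [contradiction | discriminate].
  - destruct (is_joined (st n p)) eqn:E.
    + destruct (IH eq_refl) as (k & Hk & H); exists k; split; [lia | exact H].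
    + destruct (is_echo p n) eqn:E'.
      2: { destruct (not_echo_step p n E') as (H & _); congruence. }
      destruct (join_inv_before p n Hp E) as [Hinv _].
      apply (join_inv_step p n E) in Hinv as (Hc & H0 & Ho).
      apply is_echo_spec in E' as (Hn & j & C & f & Hi & Hb).
      destruct (echo_step p n j C f Hn Hi Hb E) as (_ & _ & _ & Hiff).
      apply Hiff in Hj as [Hle Hpos]; rewrite Hc in Hle.
      exists n; repeat split; auto; try lia.
      1-3: pose proof (valid_step n) as Hok; unfold step_ok in Hok; rewrite Hi in Hok;
        rewrite Hn in Hok; apply Hok.
      (* Joining requires a positive bound, and an unset bound is 0. *)
      apply Ho; destruct (bound_set (st (S n) p)); [reflexivity|].
      rewrite H0 in Hpos by reflexivity; lra.
Qed.

Lemma joined_echo_sets_bound (p : Node) (n k j : nat) (C : list Ev) :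
  (k < n)%nat -> node k = p -> s_input (ex k) = IRecv j ->
  broadcast gamma S0 ex j = Some (MEnterEcho C true p) ->
  is_joined (st n p) = false -> bound_set (st n p) = true.
Proof.
  intros Hk Hn Hi Hb Hj; apply bound_mono with (S k); [lia|].
  destruct (echo_step p k j C true Hn Hi Hb) as (_ & -> & _).
  - destruct (is_joined (st k p)) eqn:E; [|reflexivity].
    rewrite (joined_mono k n p) in Hj; auto; lia.
  - apply orb_true_r.
Qed.

(** ** Knowledge of joined nodes and joining in time *)

Lemma entry_broadcast (i : nat) :
  s_input (ex i) = IEnter -> broadcast gamma S0 ex i = Some (MEnter (node i)).
Proof. intros H; rewrite (proj2 (step_run i)); unfold linput; rewrite H; reflexivity. Qed.

Lemma echo_broadcast (k i : nat) (p : Node) :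
  s_input (ex k) = IRecv i -> broadcast gamma S0 ex i = Some (MEnter p) ->
  exists C, broadcast gamma S0 ex k = Some (MEnterEcho C (is_joined (st k (node k))) p).
Proof.
  intros H Hb; rewrite (proj2 (step_run k)); unfold linput; rewrite H, Hb; simpl; eauto.
Qed.

Lemma entered_by_node (i : nat) (t : R) :
  s_input (ex i) = IEnter -> time i <= t -> entered_by ex S0 t (node i).
Proof. intros; right; exists i; auto. Qed.

(** Two deliveries of at most [D] each: the enter message to [u], and its echo back. *)
Lemma echo_received (p u : Node) (i : nat) :
  node i = p -> s_input (ex i) = IEnter -> active ex S0 (time i + 2 * D) p -> u <> p ->
  (forall t, time i <= t <= time i + D -> active ex S0 t u) ->
  exists k k' C, node k = u /\ (i < k)%nat /\
    broadcast gamma S0 ex k = Some (MEnterEcho C (is_joined (st k u)) p) /\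
    time k <= time i + D /\
    node k' = p /\ s_input (ex k') = IRecv k /\ time k' <= time i + 2 * D.
Proof.
  intros <- Hi Ha Hu Hact.
  destruct (delivery i (MEnter (node i)) u) as (k & <- & Hk & Hkt & Hik); auto.
  { apply entry_broadcast; assumption. }
  destruct (echo_broadcast k i (node i) Hk (entry_broadcast i Hi)) as (C & HC).
  pose proof (time_mono i k ltac:(lia)).
  destruct (delivery k _ (node i) HC) as (k' & Hn & Hk' & Ht & Hkk); auto.
  { intros t Ht; apply active_anti with (time i) (time i + 2 * D); [|lra|assumption].
    apply entered_by_node; [assumption | lra]. }
  exists k, k', C; repeat split; auto; lra.
Qed.

Lemma unchurned_active (b t v : R) (u : Node) :
  b <= t <= v -> present ex S0 b u -> ~ churn_in ex b v u -> ~ crashed_by ex v u ->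
  active ex S0 t u.
Proof.
  intros Ht Hpr Hch Hcr; pose proof (proj1 Hpr); apply active_anti with b v; auto.
  split; [|assumption]; apply present_stays with b; auto; lra.
Qed.

(* The inequality on times is strict: a message may be delivered exactly [D] after its broadcast,
   in a step that follows step [n] but has the same time. *)
Definition knows (n : nat) (q : Node) : Prop :=
  (forall r, In r S0 -> In (EvEnter r) (changes (st n q))) /\
  (forall m e, step_event ex m e -> time m + 2 * D < time n -> In e (changes (st n q))).

Lemma initially_known (q r : Node) :
  In q S0 -> In r S0 -> In (EvEnter r) (changes (st 0 q)).
Proof.
  intros Hq Hr; unfold st; simpl; unfold init_state.
  destruct (in_dec Nat.eq_dec q S0); [|contradiction]; simpl.
  apply in_flat_map; exists r; simpl; auto.
Qed.

Context (HD : 0 < D).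

Lemma lt_Rmax0 (a c : R) : 0 <= a -> a < Rmax 0 c -> a < c.
Proof. unfold Rmax; destruct (Rle_dec _ _); lra. Qed.

(** An initial node was there at every event, so the original broadcast reaches it directly within
    [D]. *)
Lemma initial_knows (n : nat) (q : Node) :
  In q S0 -> active_before ex S0 n q -> knows n q.
Proof.
  intros Hq Ha; split.
  - intros r Hr; apply changes_mono with O; [lia | apply initially_known; assumption].
  - intros m e He Ht; destruct (step_event_message m e He) as (H & x & Hx & Hin).
    destruct (Nat.eq_dec q (node m)) as [->|Hne].
    + apply changes_mono with (S m); [apply time_lt; lra | assumption].
    + apply known_delivered with m x; auto; [left; assumption | lra].
Qed.

(** * The set counted when the join bound is fixed *)

Section Bound_set.
Context (p : Node) (k j : nat) (C : list Ev).
Context (Hnk : node k = p) (Hik : s_input (ex k) = IRecv j)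
        (Hbj : broadcast gamma S0 ex j = Some (MEnterEcho C true p))
        (Hknows : knows j (node j)).

(** Events before [b] are known to the sender of the echo by [Hknows]. The maximum with 0 keeps the
    window within the times covered by the environment assumptions. *)
Let b := Rmax 0 (time j - 2 * D).
Let c := union_ev (changes (st k p)) C.

Lemma base_nonneg : 0 <= b.
Proof. apply Rmax_l. Qed.

Lemma base_ge : time j - 2 * D <= b.
Proof. apply Rmax_r. Qed.

Lemma before_base (m : nat) : time m < b -> time m + 2 * D < time j.
Proof.
  intros H; apply lt_Rmax0 in H; [lra | apply time_nonneg].
Qed.

Lemma echo_contains (e : Ev) : In e (changes (st j (node j))) -> In e C.
Proof.
  intros H; apply broadcast_echo in Hbj as (-> & _); apply in_add_ev; auto.
Qed.

Lemma c_incl (e : Ev) : In e C -> In e c.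
Proof. intros; apply in_union_ev; auto. Qed.

Lemma c_sound (e : Ev) : In e c -> event_before ex S0 (S k) e.
Proof.
  intros H; apply changes_sound with p; apply in_union_ev in H as [H|H].
  - apply changes_mono with k; auto.
  - rewrite <- Hnk; eapply recv_incl; eauto.
Qed.

Lemma before_Sk (m : nat) : (m < S k)%nat -> time k <= b + 3 * D -> time m <= b + 3 * D.
Proof. intros H Hk; pose proof (time_mono m k ltac:(lia)); lra. Qed.

(** A node that left before [b] is excluded because the sender's set contains its leave. Any other
    counted node entered by step [k], hence by [b] or inside the window. *)
Lemma present_set_upper (r : Node) :
  time k <= b + 3 * D -> In r (present_set c) ->
  present ex S0 b r \/ churn_in ex b (b + 3 * D) r.
Proof.
  intros Hk Hr; apply in_present_set in Hr as [He Hl].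
  destruct (classic (left_by ex b r)) as [(m & Hm & Ht)|Hnl].
  - destruct (Rlt_le_dec (time m) b) as [Hlt|Hge].
    + exfalso; apply Hl, c_incl, echo_contains.
      apply Hknows with m; [right; exists r; auto | apply before_base, Hlt].
    + right; exists m; split; [lra | auto].
  - apply c_sound in He as [He|(m & Hm & Hn & Hi)].
    + left; split; [left|]; assumption.
    + apply before_Sk in Hm; [|assumption].
      destruct (Rle_lt_dec (time m) b).
      * left; split; [right; exists m; auto | assumption].
      * right; exists m; split; [lra | auto].
Qed.

(** The entry precedes [b], so the sender knows it; a recorded leave would have really happened by
    step [k], contradicting presence at [b] or the absence of churn. *)
Lemma present_set_lower (r : Node) :
  time k <= b + 3 * D -> present ex S0 b r -> ~ churn_in ex b (b + 3 * D) r ->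
  In r (present_set c).
Proof.
  intros Hk [He Hl] Hch; apply in_present_set; split.
  - apply c_incl, echo_contains.
    destruct He as [He|(m & Hn & Hi & Ht)]; [apply Hknows; assumption|].
    apply Hknows with m; [left; subst r; auto|].
    (* The window is closed, so an entry exactly at [b] would count as churn. *)
    apply before_base, Rnot_le_lt; intros Hge.
    apply Hch; exists m; split; [lra | auto].
  - intros H; apply c_sound in H as (m & Hm & Hi).
    apply before_Sk in Hm; [|assumption].
    destruct (Rle_lt_dec b (time m)).
    + apply Hch; exists m; auto.
    + apply Hl; exists m; split; [assumption | lra].
Qed.

(** The source of the window length: [time j <= b + 2 * D], and the echo takes at most [D] because
    [p] had entered when it was sent. *)
Lemma bound_times (i : nat) :
  node i = p -> s_input (ex i) = IEnter ->
  (i < j)%nat /\ (j < k)%nat /\ time i <= time j /\ time j <= time k /\ time k <= b + 3 * D.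
Proof.
  intros Hi He; pose proof Hbj as Hb.
  apply broadcast_echo in Hb as (_ & _ & _ & i' & _ & He' & Hp' & Hij).
  replace i' with i in Hij by (apply enter_unique; congruence).
  assert (j < k)%nat.
  { pose proof (valid_step k) as Hok; unfold step_ok in Hok; rewrite Hik in Hok; tauto. }
  pose proof (time_mono i j ltac:(lia)); pose proof (time_mono j k ltac:(lia)).
  repeat split; auto; pose proof base_ge.
  enough (time k <= time j + D) by lra.
  eapply recv_delay; eauto; rewrite Hnk, <- Hi; apply entered_by_node; assumption.
Qed.

End Bound_set.

(** * The simultaneous induction on steps *)

Context (alpha Delta : R) (Nmin : nat).
Context (Ha0 : 0 <= alpha) (Ha1 : alpha < 1) (HDel0 : 0 <= Delta).
Context (HN : 1 < ((1 - alpha) ^ 3 - Delta * (1 + alpha) ^ 3) * INR Nmin).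
Context (Hg1 : 1 / (INR Nmin * (1 - alpha) ^ 3)
         + (1 + Delta) * ((1 + alpha) ^ 3 / (1 - alpha) ^ 3) - 1 <= gamma).
Context (Hg2 : gamma <= (1 - alpha) ^ 3 / (1 + alpha) ^ 3 - Delta).
Context (Henv : env_assumptions ex S0 D alpha Delta Nmin).

Definition joined_know (n : nat) : Prop :=
  forall q, is_joined (st n q) = true -> active_before ex S0 n q -> knows n q.

Definition late_joined (n : nat) : Prop :=
  forall i, ~ In (node i) S0 -> s_input (ex i) = IEnter -> time i + 2 * D < time n ->
    active ex S0 (time i + 2 * D) (node i) -> is_joined (st n (node i)) = true.

(** Take a node active throughout a window starting at [max(0, time i - 2 * D)]. Without churn in
    the window it is initial or entered more than [2 * D] before [p], so it has joined by the time
    it echoes, by the induction hypothesis. *)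
Lemma joined_echoer (i : nat) :
  ~ In (node i) S0 -> s_input (ex i) = IEnter -> active ex S0 (time i + 2 * D) (node i) ->
  (forall n, time n <= time i + D -> late_joined n) ->
  exists k j C, time k <= time i + 2 * D /\ node k = node i /\ s_input (ex k) = IRecv j /\
    broadcast gamma S0 ex j = Some (MEnterEcho C true (node i)).
Proof.
  intros Hp Hi Ha IH.
  set (b := Rmax 0 (time i - 2 * D)).
  assert (Hb : 0 <= b) by apply Rmax_l.
  assert (Hb2 : time i - 2 * D <= b) by apply Rmax_r.
  pose proof (time_nonneg i) as Hi0.
  assert (Hb3 : b <= time i) by (apply Rmax_lub; lra).
  destruct (window alpha Delta gamma D Nmin S0 ex HD Ha0 HDel0 Hex Henv b Hb)
    as (N & e & l & U & W & V & B & HNm & He & Hl & Hel & _ & _ & _ & _ & _ & _ & HVp & HVl & _).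
  pose proof (pos_INR Nmin) as HM.
  pose proof (M_pos alpha Delta (INR Nmin) HM HN) as HM'.
  pose proof (gamma_pos alpha Delta gamma (INR Nmin) Ha0 Ha1 HDel0 HM HN Hg1) as Hpos.
  pose proof (survivors_exceed_bound alpha Delta gamma (INR Nmin) Ha0 Ha1 HDel0 HM HN Hg1 Hg2
                N e l ltac:(lra) He Hel) as Hsurv.
  assert (HV : 0 < INR (length V)) by nra.
  destruct V as [|u V]; [simpl in HV; lra|].
  destruct (proj1 (HVp u) (or_introl eq_refl)) as ((Hpres & Hch) & Hcr).
  assert (Hui : u <> node i).
  { intros ->; apply Hch; exists i; split; [lra | auto]. }
  assert (Hact : forall t, time i <= t <= time i + D -> active ex S0 t u).
  { intros t Ht; apply unchurned_active with b (b + 3 * D); auto; lra. }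
  destruct (echo_received (node i) u i eq_refl Hi Ha Hui Hact)
    as (k & k' & C & Hk & Hik & HC & Hkt & Hk' & Hi' & Ht').
  exists k', k, C; repeat split; auto.
  replace true with (is_joined (st k u)); [assumption|].
  destruct Hpres as [[Hu|(m & Hm & Him & Htm)] _].
  - apply joined_mono with O; [lia|]; unfold st; simpl; unfold init_state.
    destruct (in_dec Nat.eq_dec u S0); [reflexivity | contradiction].
  - destruct (classic (In u S0)) as [Hu|Hu].
    { apply joined_mono with O; [lia|]; unfold st; simpl; unfold init_state.
      destruct (in_dec Nat.eq_dec u S0); [reflexivity | contradiction]. }
    assert (Hmb : time m < b).
    { apply Rnot_le_lt; intros Hge; apply Hch; exists m; split; [lra | auto]. }
    apply lt_Rmax0 in Hmb; [|apply time_nonneg].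
    pose proof (time_mono i k ltac:(lia)).
    subst u; apply (IH k Hkt); auto; [lra|].
    apply active_anti with (time m) (time i); [|lra|apply Hact; lra].
    apply entered_by_node; [assumption | lra].
Qed.

(* The bound is set while only [gamma (N + e)] nodes can be counted as present, and that many
   of the nodes present throughout the window answer the entering node. *)
Lemma late_joined_first (n i : nat) :
  ~ In (node i) S0 -> s_input (ex i) = IEnter -> time i + 2 * D < time n ->
  (forall k, (k < n)%nat -> time k <= time i + 2 * D) ->
  active ex S0 (time i + 2 * D) (node i) ->
  (forall k, (k < n)%nat -> joined_know k /\ late_joined k) ->
  is_joined (st n (node i)) = true.
Proof.
  intros Hp Hi Hn Hfirst Ha IH.
  destruct (is_joined (st n (node i))) eqn:Hj; [reflexivity|exfalso].
  destruct (joined_echoer i Hp Hi Ha) as (k0 & j0 & C0 & Ht0 & Hn0 & Hi0 & Hb0).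
  { intros k Hk; apply IH, time_lt; lra. }
  assert (Hset : bound_set (st n (node i)) = true).
  { eapply joined_echo_sets_bound; eauto; apply time_lt; lra. }
  destruct (join_inv_before (node i) n Hp Hj) as ((Hcnt & _ & Horig) & Hlt).
  (* The echo found above only shows that the bound is set; the echo that set it may be another one,
     and it is this one that determines the window. *)
  destruct (Horig Hset) as (k & j & C & Hk & Hnk & Hik & Hbj & Hjb).
  destruct (bound_times (node i) k j C Hnk Hik Hbj i eq_refl Hi)
    as (Hij & Hjk & Htij & Htjk & Htk).
  assert (Hknows : knows j (node j)).
  { pose proof Hbj as Hb; apply broadcast_echo in Hb as (_ & Hf & Hact & _).
    apply IH; auto; lia. }
  pose proof (present_set_upper (node i) k j C Hnk Hik Hbj Hknows) as Hupper.
  pose proof (present_set_lower (node i) k j C Hnk Hik Hbj Hknows) as Hlower.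
  pose proof (Hfirst k Hk) as Hkt.
  pose proof (base_nonneg j) as Hb; pose proof (base_ge j) as Hb2.
  pose proof (time_nonneg i) as Hti.
  assert (Hb3 : Rmax 0 (time j - 2 * D) <= time i) by (apply Rmax_lub; lra).
  set (b := Rmax 0 (time j - 2 * D)) in *.
  set (P := present_set _) in *.
  destruct (window alpha Delta gamma D Nmin S0 ex HD Ha0 HDel0 Hex Henv b Hb)
    as (N & e & l & U & W & V & B & HNm & He & Hl & Hel & HU & HUl & _ & _ & _ &
        HVnd & HVp & HVl & _).
  pose proof (pos_INR Nmin) as HM.
  pose proof (M_pos alpha Delta (INR Nmin) HM HN) as HM'.
  pose proof (gamma_pos alpha Delta gamma (INR Nmin) Ha0 Ha1 HDel0 HM HN Hg1) as Hpos.
  pose proof (survivors_exceed_bound alpha Delta gamma (INR Nmin) Ha0 Ha1 HDel0 HM HN Hg1 Hg2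
                N e l ltac:(lra) He Hel) as Hsurv.
  assert (HPU : INR (length P) <= N + e).
  { rewrite <- HUl; apply le_INR, NoDup_incl_length; [apply NoDup_present_set|].
    intros r Hr; apply HU, Hupper; assumption. }
  (* This also makes [P] nonempty, so the bound is positive and does not block the join test. *)
  assert (HVP : INR (length V) <= INR (length P)).
  { apply le_INR, NoDup_incl_length; [assumption|].
    intros r Hr; apply HVp in Hr as [[? ?] _]; apply Hlower; assumption. }
  assert (HVe : INR (length V) <= INR (length (echoes (node i) n))).
  { rewrite <- (proj2 (echoes_senders (node i) n)).
    apply le_INR, NoDup_incl_length; [assumption|].
    intros u Hu; apply HVp in Hu as [[Hpres Hch] Hcr].
    assert (Hui : u <> node i).
    { intros ->; apply Hch; exists i; split; [lra | auto]. }
    destruct (echo_received (node i) u i eq_refl Hi Ha Hui)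
      as (k1 & k2 & C1 & Hk1 & _ & HC & _ & Hk2 & Hi2 & Ht2).
    { intros t Ht; apply unchurned_active with b (b + 3 * D); auto; lra. }
    apply in_senders; exists k2, k1, C1, (is_joined (st k1 u)).
    repeat split; auto; apply time_lt; lra. }
  rewrite Hjb, Hcnt in Hlt.
  assert (0 < INR (length P)) by nra.
  assert (0 < gamma * INR (length P)) by nra.
  apply Hlt in H0; nra.
Qed.

Lemma first_after (T : R) (n : nat) :
  T < time n -> exists n', (n' <= n)%nat /\ T < time n' /\ forall k, (k < n')%nat -> time k <= T.
Proof.
  induction n as [|n IH]; intros H.
  - exists O; repeat split; auto; intros; lia.
  - destruct (Rlt_le_dec T (time n)) as [Hlt|Hle].
    + destruct (IH Hlt) as (n' & ? & ?); exists n'; split; [lia | assumption].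
    + exists (S n); repeat split; auto; intros k Hk.
      pose proof (time_mono k n ltac:(lia)); lra.
Qed.

Lemma late_joined_step (n : nat) :
  (forall k, (k < n)%nat -> joined_know k /\ late_joined k) -> late_joined n.
Proof.
  intros IH i Hp Hi Ht Ha.
  destruct (first_after (time i + 2 * D) n Ht) as (n' & Hn' & Ht' & Hf).
  apply joined_mono with n'; [assumption|].
  apply late_joined_first; auto; intros k Hk; apply IH; lia.
Qed.

Lemma echo_transfer (k j n : nat) (C : list Ev) (f : bool) (p : Node) (e : Ev) :
  s_input (ex k) = IRecv j -> broadcast gamma S0 ex j = Some (MEnterEcho C f p) ->
  In e (changes (st j (node j))) -> (k < n)%nat -> In e (changes (st n (node k))).
Proof.
  intros Hi Hb He Hk; apply changes_mono with (S k); [lia|].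
  eapply recv_incl; eauto; simpl.
  apply broadcast_echo in Hb as (-> & _); apply in_add_ev; auto.
Qed.

Lemma exists_outside (l B : list Node) :
  NoDup l -> (length B < length l)%nat -> exists u, In u l /\ ~ In u B.
Proof.
  intros Hl Hlen; apply NNPP; intros H.
  enough (length l <= length B)%nat by lia.
  apply NoDup_incl_length; [assumption|].
  intros u Hu; apply NNPP; intros Hn; apply H; eauto.
Qed.

(* The nodes echoing before the join outnumber those that churned or crashed around the event,
   so some echoing node was active for [D] after the event and learnt of it in time.  Nodes entering
   after the broadcast of an enter message may receive it arbitrarily late, so echoes can come from
   nodes that entered as late as [b + 4 D]. *)
Lemma joined_know_step (n : nat) :
  (forall k, (k < n)%nat -> joined_know k /\ late_joined k) -> joined_know n.
Proof.
  intros IH p Hj Ha.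
  destruct (classic (In p S0)) as [Hp|Hp]; [apply initial_knows; assumption|].
  destruct (active_before_entry n p Hp Ha) as (i & Hin & Hip & Hi).
  destruct (join_step p n Hp Hj) as (kj & Hkj & Hnkj & Hakj & Hjkj & Horig & Hle).
  destruct Horig as (k & j & C & Hk & Hnk & Hik & Hbj & Hjb).
  destruct (bound_times p k j C Hnk Hik Hbj i Hip Hi) as (Hij & Hjk & Htij & Htjk & Htk).
  assert (Hknows : knows j (node j)).
  { pose proof Hbj as Hb; apply broadcast_echo in Hb as (_ & Hf & Hact & _).
    apply IH; auto; lia. }
  (* Otherwise [late_joined] at [kj] would have [p] joined before its joining step. It follows that
     all echoes counted at the join were sent by [b + 4 * D]. *)
  assert (Htkj : time kj <= time i + 2 * D).
  { apply Rnot_lt_le; intros Hlt.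
    assert (is_joined (st kj (node i)) = true); [|congruence].
    apply (IH kj Hkj); auto; [congruence|].
    apply active_of_before with kj (time i); try lra; [|congruence].
    apply entered_by_node; [assumption | lra]. }
  pose proof (present_set_lower p k j C Hnk Hik Hbj Hknows) as Hlower.
  pose proof (base_nonneg j) as Hb; pose proof (base_ge j) as Hb2.
  pose proof (before_base j) as Hbb.
  pose proof (time_nonneg i) as Hti; pose proof (time_mono k kj ltac:(lia)) as Htkkj.
  assert (Hb3 : Rmax 0 (time j - 2 * D) <= time i) by (apply Rmax_lub; lra).
  set (b := Rmax 0 (time j - 2 * D)) in *.
  set (P := present_set _) in *.
  destruct (window alpha Delta gamma D Nmin S0 ex HD Ha0 HDel0 Hex Henv b Hb)
    as (N & e0 & l & U & W & V & B & HNm & He & Hl & Hel & _ & _ & HWnd & HWp & HWl &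
        _ & _ & _ & HBp & HBl).
  pose proof (pos_INR Nmin) as HM.
  pose proof (gamma_pos alpha Delta gamma (INR Nmin) Ha0 Ha1 HDel0 HM HN Hg1) as Hpos.
  pose proof (echoes_exceed_bad alpha Delta gamma (INR Nmin) Ha0 Ha1 HDel0 HM HN Hg1 Hg2
                N e0 l HNm He Hel Hl) as Hbad.
  assert (HWP : INR (length W) <= INR (length P)).
  { apply le_INR, NoDup_incl_length; [assumption|].
    intros r Hr; apply HWp in Hr as [? ?]; apply Hlower; assumption. }
  (* The join test gives at least [gamma] times the size of [P] distinct senders, which exceeds the
     size of [B] by [HWP] and [Hbad]. *)
  destruct (exists_outside (map sender (echoes p (S kj))) B) as (u & Hu & HuB).
  { apply echoes_senders. }
  { apply INR_lt; rewrite (proj2 (echoes_senders p (S kj))); rewrite Hjb in Hle; nra. }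
  apply in_senders in Hu as (ku' & ku & Cu & fu & Hku' & Hnku' & Hiku' & <- & Hbku).
  pose proof Hbku as Hbku2.
  apply broadcast_echo in Hbku2 as (_ & _ & Haku & i' & Hiku & Hi' & Hpi' & Hiku2).
  assert (i' = i) by (apply enter_unique; congruence); subst i'.
  assert (Hku : (ku < ku')%nat).
  { pose proof (valid_step ku') as Hok; unfold step_ok in Hok; rewrite Hiku' in Hok; tauto. }
  pose proof (time_mono i ku ltac:(lia)) as Htiku.
  pose proof (time_mono ku kj ltac:(lia)) as Htku.
  assert (Hch4 : ~ churn_in ex b (b + 4 * D) (node ku)) by (intros H; apply HuB, HBp; auto).
  assert (Hch : ~ churn_in ex b (b + 3 * D) (node ku)).
  { intros (a & Hta & H); apply Hch4; exists a; split; [lra | assumption]. }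
  assert (Hup : p <> node ku).
  { intros Hp'; apply Hch; exists i; split; [lra | left; split; congruence]. }
  assert (Huse : forall e, In e (changes (st ku (node ku))) -> In e (changes (st n p))).
  { intros e H; rewrite <- Hnku'; eapply echo_transfer; eauto; lia. }
  assert (Huse1 : forall e, In e (changes (st j (node j))) -> In e (changes (st n p))).
  { intros e H; rewrite <- Hnk; eapply echo_transfer; eauto; lia. }
  split; [intros r Hr; apply Huse1, Hknows, Hr|].
  intros m e Hme Hmt.
  destruct (step_event_message m e Hme) as (Hself & x & Hx & Hex').
  (* Events from the entry of [p] on are heard directly, events before [b] come with the echo that
     set the bound, and those in between come through [node ku]. *)
  destruct (Rle_lt_dec (time i) (time m)) as [Him|Him].
  { destruct (Nat.eq_dec p (node m)) as [->|Hne].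
    - apply changes_mono with (S m); [apply time_lt; lra | assumption].
    - apply known_delivered with m x; auto; [|lra].
      rewrite <- Hip; apply entered_by_node; assumption. }
  destruct (Rlt_le_dec (time m) b) as [Hmb|Hmb].
  { apply Huse1; apply Hknows with m; auto. }
  (* The echo at [ku] is sent by [b + 4 * D], so without churn up to then its sender must have
     entered before [b]. *)
  assert (Hpres : present ex S0 b (node ku)).
  { destruct Haku as (Hent & Hlft & _); split.
    - destruct Hent as [|(a & Hak & Hna & Hia)]; [left; assumption|].
      right; exists a; repeat split; auto.
      apply Rnot_lt_le; intros Hlt; apply Hch4; exists a.
      pose proof (time_mono a ku ltac:(lia)); split; [lra | auto].
    - intros (a & Hia & Hta); apply Hlft; exists a; split; [|assumption].
      apply time_lt; lra. }
  assert (Hact : forall t, time m <= t <= time m + D -> active ex S0 t (node ku)).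
  { intros t Ht; apply unchurned_active with b (b + 3 * D); auto; [lra|].
    intros Hc; apply HuB, HBp; right; split; [|assumption].
    apply present_stays with b; auto; lra. }
  destruct (Nat.eq_dec (node ku) (node m)) as [Hum|Hum].
  { apply Huse; rewrite Hum; apply changes_mono with (S m); [apply time_lt; lra | assumption]. }
  destruct (delivery m x (node ku) Hx Hum Hact) as (kk & Hnkk & Hikk & Htkk & Hmkk).
  destruct (step_event_relay m kk e Hme Hikk) as (Hsk & y & Hy & Hey).
  (* If the event arrives before the echo to [p], the echo contains it. If it arrives later, its
     relay is sent after [p] entered and reaches [p] by [time m + 2 * D]. The two receptions cannot
     coincide, as [m] would then be the entry of [p]. *)
  destruct (Nat.lt_trichotomy kk ku) as [L|[E|L]].
  - apply Huse; rewrite <- Hnkk; apply changes_mono with (S kk); [lia | assumption].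
  - exfalso; assert (m = i) by congruence; subst m; lra.
  - pose proof (time_mono ku kk ltac:(lia)).
    apply known_delivered with kk y; auto; [congruence| |lra].
    rewrite <- Hip; apply entered_by_node; [assumption | lra].
Qed.

Lemma knowledge_and_joining (n : nat) : joined_know n /\ late_joined n.
Proof.
  induction n as [n IH] using lt_wf_ind; split.
  - apply joined_know_step; assumption.
  - apply late_joined_step; assumption.
Qed.

Lemma joins_in_time (i : nat) :
  ~ In (node i) S0 -> s_input (ex i) = IEnter -> active ex S0 (time i + 2 * D) (node i) ->
  exists k, time k <= time i + 2 * D /\ is_joined (st (S k) (node i)) = true.
Proof.
  intros Hp Hi Ha.
  assert (Hunb : exists n, time i + 2 * D < time n) by apply Hex.
  destruct Hunb as (n & Hn).
  (* The state before the first step beyond the deadline is the state after the last step [k] within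
     it; that first step is not step 0, since step [i] lies within the deadline. *)
  destruct (first_after _ n Hn) as ([|k] & _ & Ht & Hf).
  - pose proof (time_mono 0 i ltac:(lia)); lra.
  - exists k; split; [apply Hf; lia|].
    apply knowledge_and_joining; assumption.
Qed.

End Execution.

Theorem theorem1 (alpha Delta gamma D : R) (Nmin : nat) (S0 : list Node)
  (ex : Execution)
  (HD : 0 < D)
  (Ha0 : 0 <= alpha) (Ha1 : alpha < 1)
  (HDel0 : 0 <= Delta) (HDel1 : Delta < 1)
  (Ha : alpha <= 1 - Rpower 2 (- (1 / 4)))
  (HN : 1 < ((1 - alpha) ^ 3 - Delta * (1 + alpha) ^ 3) * INR Nmin)
  (Hg1 : 1 / (INR Nmin * (1 - alpha) ^ 3)
         + (1 + Delta) * ((1 + alpha) ^ 3 / (1 - alpha) ^ 3) - 1 <= gamma)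
  (Hg2 : gamma <= (1 - alpha) ^ 3 / (1 + alpha) ^ 3 - Delta)
  (Hex : valid_execution gamma S0 D ex)
  (Henv : env_assumptions ex S0 D alpha Delta Nmin) :
  forall (p : Node) (i : nat),
    ~ In p S0 ->
    s_node (ex i) = p -> s_input (ex i) = IEnter ->
    active ex S0 (s_time (ex i) + 2 * D) p ->
    exists k, s_time (ex k) <= s_time (ex i) + 2 * D /\
              is_joined (state_after gamma S0 ex k p) = true.
Proof.
  intros p i Hp <- Hi Hact.
  exact (joins_in_time gamma S0 D ex Hex HD alpha Delta Nmin
           Ha0 Ha1 HDel0 HN Hg1 Hg2 Henv i Hp Hi Hact).
Qed.
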